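(* Consider the uplink total transmit power minimization problem $$\mathcal{P}1:\quad \min_{\mathbf{f}_{i,u},\,\lambda_{i,u}\ge 0,\ \forall i,u}\ \sum_{i,u}\lambda_{i,u}\quad\text{s.t.}\quad \max_{\mathbf{f}_{i,u}}\Gamma^{\rm ul}_{i,u}\ \ge\ \gamma_{i,u}\quad\forall i,u,$$ where $\Gamma^{\rm ul}_{i,u}$ is the quantized uplink SINR defined in the context, and assume that $\mathcal{P}1$ is feasible. Then the optimal transmit powers of $\mathcal{P}1$ are the $\lambda_{i,u}$ given (implicitly) by $$\lambda_{i,u}=\frac{1}{\alpha\left(1+\frac{1}{\gamma_{i,u}}\right)\mathbf{h}_{i,i,u}^H\mathbf{K}_i^{-1}(\boldsymbol{\Lambda})\mathbf{h}_{i,i,u}}\qquad\forall i,u,$$ where $$\mathbf{K}_i(\boldsymbol{\Lambda})=\mathbf{I}_{N_b}+\alpha\sum_{j,v}\lambda_{j,v}\mathbf{h}_{i,j,v}\mathbf{h}_{i,j,v}^H+\beta\,\mathrm{diag}(\mathbf{H}_i\boldsymbol{\Lambda}\mathbf{H}_i^H),$$ with the (SINR-maximizing) linear MMSE equalizer given as $$\mathbf{f}_{i,u}=\Big[\alpha^2\sum_{(j,v)\neq(i,u)}\lambda_{j,v}\mathbf{h}_{i,j,v}\mathbf{h}_{i,j,v}^H+\alpha\mathbf{I}_{N_b}+\alpha\beta\,\mathrm{diag}(\mathbf{H}_i\boldsymbol{\Lambda}\mathbf{H}_i^H)\Big]^{-1}\mathbf{h}_{i,i,u}.$$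
   Context: Setting. $N_c,N_u,N_b$ are positive integers (numbers of cells, users per cell, antennas per base station). Indices: $i,j\in\{1,\dots,N_c\}$, $u,v\in\{1,\dots,N_u\}$; $\sum_{i,u}$ is the sum over all such pairs. The channels $\mathbf{h}_{i,j,u}\in\mathbb{C}^{N_b}$ (between base station $i$ and user $u$ of cell $j$) are given, $\mathbf{H}_{i,j}=[\mathbf{h}_{i,j,1},\dots,\mathbf{h}_{i,j,N_u}]$ and $\mathbf{H}_i=[\mathbf{H}_{i,1},\dots,\mathbf{H}_{i,N_c}]\in\mathbb{C}^{N_b\times N_cN_u}$. The quantizer gain is $\alpha\in(0,1]$ and $\beta=1-\alpha$. The target SINRs are $\gamma_{i,u}>0$. For a square matrix $\mathbf{A}$, $\mathrm{diag}(\mathbf{A})$ is the diagonal matrix with the same diagonal entries as $\mathbf{A}$. Uplink. For powers $\lambda_{i,u}\ge0$ let $\boldsymbol{\Lambda}$ be the $N_cN_u\times N_cN_u$ diagonal matrix with entries $\lambda_{1,1},\dots,\lambda_{1,N_u},\dots,\lambda_{N_c,1},\dots,\lambda_{N_c,N_u}$. The quantization noise covariance is $\mathbf{C}_{\mathbf{q}^{\rm ul}_i\mathbf{q}^{\rm ul}_i}=\alpha\beta\,\mathrm{diag}(\mathbf{H}_i\boldsymbol{\Lambda}\mathbf{H}_i^H+\mathbf{I}_{N_b})$. For a combiner $\mathbf{f}_{i,u}\in\mathbb{C}^{N_b}\setminus\{\mathbf{0}\}$, $$\Gamma^{\rm ul}_{i,u}=\frac{\alpha^2\lambda_{i,u}|\mathbf{f}_{i,u}^H\mathbf{h}_{i,i,u}|^2}{\alpha^2\sum_{(j,v)\ne(i,u)}\lambda_{j,v}|\mathbf{f}_{i,u}^H\mathbf{h}_{i,j,v}|^2+\mathbf{f}_{i,u}^H\mathbf{C}_{\mathbf{q}^{\rm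 ul}_i\mathbf{q}^{\rm ul}_i}\mathbf{f}_{i,u}+\alpha^2\|\mathbf{f}_{i,u}\|^2}.$$ Combiners matter only up to nonzero scaling, since $\Gamma^{\rm ul}_{i,u}$ is invariant under scaling of $\mathbf{f}_{i,u}$. *)

(* Defs.v *)
From HB Require Import structures.
From mathcomp Require Import all_boot all_order all_algebra.
From mathcomp Require Import sesquilinear spectral.
From mathcomp Require Import reals.
From mathcomp Require Export complex.

Set Implicit Arguments.
Unset Strict Implicit.
Unset Printing Implicit Defensive.

Import Order.TTheory GRing.Theory Num.Theory.
Local Open Scope ring_scope.
Local Open Scope complex_scope.
Local Open Scope sesquilinear_scope.

(* diag(A): the off-diagonal entries of A are replaced by 0. *)
Definition diag_part (C : pzRingType) (n : nat) (A : 'M[C]_n) : 'M[C]_n :=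
  diag_mx (\row_k A k k).

Section Uplink.

Variables (R : realType) (Nc Nu Nb : nat).

(* h i j u is the channel between base station i and user u of cell j. *)
Implicit Types (h : 'I_Nc -> 'I_Nc -> 'I_Nu -> 'cV[R[i]]_Nb) (alpha : R)
  (gamma lam : 'I_Nc -> 'I_Nu -> R) (i : 'I_Nc) (u : 'I_Nu)
  (f : 'I_Nc -> 'I_Nu -> 'cV[R[i]]_Nb).

(* H_i = [H_{i,1}, ..., H_{i,Nc}] with H_{i,j} = [h_{i,j,1}, ..., h_{i,j,Nu}] *)
Definition channel_mx h i : 'M[R[i]]_(Nb, \sum_(j < Nc) Nu) :=
  \mxrow_(j < Nc) (\matrix_(k < Nb, v < Nu) h i j v k 0).

Definition power_mx lam : 'M[R[i]]_(\sum_(j < Nc) Nu) :=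
  diag_mx (\mxrow_(j < Nc) (\row_(v < Nu) (lam j v)%:C)).

(* H_i Lambda H_i^H *)
Definition received_cov h lam i : 'M[R[i]]_Nb :=
  channel_mx h i *m power_mx lam *m (channel_mx h i)^t*.

(* Covariance of the uplink quantization noise, with beta = 1 - alpha. *)
Definition qnoise_cov h alpha lam i : 'M[R[i]]_Nb :=
  (alpha * (1 - alpha))%:C *: diag_part (received_cov h lam i + 1%:M).

(* The uplink SINR of user u of cell i for the combiner g. For lam >= 0 it is
   a nonnegative real; it is valued in R[i], whose order x <= y means
   Im x = Im y and Re x <= Re y, so comparing it with (c%:C) is comparing
   real numbers. *)
Definition sinr h alpha lam i u (g : 'cV[R[i]]_Nb) : R[i] :=
  (alpha ^+ 2 * lam i u)%:C * `|(g^t* *m h i i u) 0 0| ^+ 2 /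
  ((alpha ^+ 2)%:C *
     (\sum_(p : 'I_Nc * 'I_Nu | p != (i, u))
        (lam p.1 p.2)%:C * `|(g^t* *m h i p.1 p.2) 0 0| ^+ 2)
   + (g^t* *m qnoise_cov h alpha lam i *m g) 0 0
   + (alpha ^+ 2)%:C * \sum_(k < Nb) `|g k 0| ^+ 2).

Definition sinr_maximizer h alpha lam i u (g : 'cV[R[i]]_Nb) : Prop :=
  g != 0 /\
  forall g' : 'cV[R[i]]_Nb, g' != 0 ->
    sinr h alpha lam i u g' <= sinr h alpha lam i u g.

(* Feasibility for the power minimization problem in the variables (f, lam):
   the combiners f attain the maxima max_g sinr(g) that appear in the
   constraints max_g sinr(g) >= gamma. *)
Definition P1_feasible h alpha gamma f lam : Prop :=
  forall i u,
    [/\ 0 <= lam i u,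
        sinr_maximizer h alpha lam i u (f i u)
      & (gamma i u)%:C <= sinr h alpha lam i u (f i u)].

Definition P1_optimal h alpha gamma f lam : Prop :=
  P1_feasible h alpha gamma f lam /\
  forall f' lam', P1_feasible h alpha gamma f' lam' ->
    \sum_i \sum_u lam i u <= \sum_i \sum_u lam' i u.

Definition Kmx h alpha lam i : 'M[R[i]]_Nb :=
  1%:M
  + alpha%:C *: (\sum_j \sum_v (lam j v)%:C *: (h i j v *m (h i j v)^t*))
  + (1 - alpha)%:C *: diag_part (received_cov h lam i).

(* The implicit (fixed-point) characterization of the powers. The matrices
   K_i are positive definite for lam >= 0, so invmx is a genuine inverse. *)
Definition power_equation h alpha gamma lam : Prop :=
  forall i u,
    0 <= lam i u /\
    (lam i u)%:C =
      1 / (alpha%:C * (1 + 1 / (gamma i u)%:C) *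
           ((h i i u)^t* *m invmx (Kmx h alpha lam i) *m h i i u) 0 0).

Definition mmse h alpha lam i u : 'cV[R[i]]_Nb :=
  invmx ((alpha ^+ 2)%:C *:
           (\sum_(p : 'I_Nc * 'I_Nu | p != (i, u))
              (lam p.1 p.2)%:C *: (h i p.1 p.2 *m (h i p.1 p.2)^t*))
         + alpha%:C%:M
         + (alpha * (1 - alpha))%:C *: diag_part (received_cov h lam i))
  *m h i i u.

End Uplink.

(* Main.v *)
(* Write x = h^H K^-1 h for the gain of a user with channel h. By
   Cauchy-Schwarz in the inner product of the interference-plus-noise matrix M,
   the SINR is maximal exactly at the multiples of M^-1 h; as alpha K is a
   rank-one update of M, the constraint max SINR >= gamma reads lam >= T lam
   with T lam = 1 / (alpha (1 + 1/gamma) x). Since K is affine and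
   nondecreasing in lam, with constant part I, the map T is a standard
   interference function in the sense of Yates: positive, monotone, and
   T (c lam) < c T lam for c > 1. Hence the infimum of {lam | T lam <= lam} is
   a fixed point of T, and scaling shows that there is no other one. *)
Require Import Defs.
From HB Require Import structures.
From mathcomp Require Import all_boot all_order all_algebra.
From mathcomp Require Import sesquilinear ring.
From mathcomp Require Import reals complex.
From mathcomp Require boolp classical_sets.

Import Order.TTheory GRing.Theory Num.Theory.
Local Open Scope ring_scope.
Local Open Scope sesquilinear_scope.

(** * Hermitian forms, the Cauchy-Schwarz inequality and order properties of the inverse *)

Section HermitianForms.

Context {C : numClosedFieldType} {n : nat}.
Implicit Types (A B : 'M[C]_n) (v w g h : 'cV[C]_n).

Definition qform A v : C := (v^t* *m A *m v) 0 0.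

Definition posdef A : Prop :=
  A^t* = A /\ forall v, v != 0 -> 0 < qform A v.

Definition possemidef A : Prop :=
  A^t* = A /\ forall v, 0 <= qform A v.

Lemma adjmxM p q r (X : 'M[C]_(p, q)) (Y : 'M[C]_(q, r)) :
  (X *m Y)^t* = Y^t* *m X^t*.
Proof. by rewrite trmx_mul map_mxM. Qed.

Lemma adjmxK p q (X : 'M[C]_(p, q)) : (X^t*)^t* = X.
Proof. by apply/matrixP=> i j; rewrite !mxE conjCK. Qed.

Lemma adjmxD p q (X Y : 'M[C]_(p, q)) : (X + Y)^t* = X^t* + Y^t*.
Proof. by rewrite linearD map_mxD. Qed.

Lemma adjmxZ p q a (X : 'M[C]_(p, q)) : (a *: X)^t* = a^* *: X^t*.
Proof. by rewrite linearZ map_mxZ. Qed.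

Lemma inner_conj v w : (v^t* *m w) 0 0 = ((w^t* *m v) 0 0)^*.
Proof. by rewrite -{1}[w]adjmxK -adjmxM !mxE. Qed.

Lemma qform0 A : qform A 0 = 0.
Proof. by rewrite /qform mulmx0 mxE. Qed.

Lemma qformD A B v : qform (A + B) v = qform A v + qform B v.
Proof. by rewrite /qform mulmxDr mulmxDl mxE. Qed.

Lemma qformZ a A v : qform (a *: A) v = a * qform A v.
Proof. by rewrite /qform -scalemxAr -scalemxAl mxE. Qed.

Lemma qform_sum (I : finType) (P : pred I) (F : I -> 'M[C]_n) v :
  qform (\sum_(k | P k) F k) v = \sum_(k | P k) qform (F k) v.
Proof. by rewrite /qform mulmx_sumr mulmx_suml summxE. Qed.

Lemma qform_diag d v :
  qform (diag_mx d) v = \sum_k d 0 k * `|v k 0| ^+ 2.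
Proof.
rewrite /qform mul_mx_diag mxE; apply: eq_bigr => k _.
by rewrite !mxE normCKC mulrA [d 0 k * _]mulrC.
Qed.

Lemma qform_scale A c v : qform A (c *: v) = `|c| ^+ 2 * qform A v.
Proof.
rewrite /qform adjmxZ -!scalemxAl -scalemxAr mxE [X in _ * X]mxE mulrA.
by rewrite normCKC.
Qed.

Lemma qform_outer h v : qform (h *m h^t*) v = `|(v^t* *m h) 0 0| ^+ 2.
Proof.
rewrite /qform mulmxA -mulmxA mxE big_ord1 normCK.
congr (_ * _); exact: inner_conj.
Qed.

Lemma qform1 v : qform 1%:M v = \sum_k `|v k 0| ^+ 2.
Proof.
rewrite -diag_const_mx qform_diag.
by apply: eq_bigr => k _; rewrite mxE mul1r.
Qed.

Lemma posdef1 : posdef 1%:M.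
Proof.
split=> [|v vN0]; first by rewrite trmx1 map_mx1.
rewrite qform1 lt_def sumr_ge0 ?andbT; last by move=> k _; rewrite exprn_ge0.
apply: contraNneq vN0 => /psumr_eq0P v0.
apply/eqP/matrixP=> k j; rewrite ord1 [RHS]mxE.
apply/eqP; rewrite -normr_eq0 -sqrf_eq0 v0 // => l _.
by rewrite exprn_ge0.
Qed.

Lemma posdefW A : posdef A -> possemidef A.
Proof.
case=> Ah Apos; split=> // v; have [->|vN0] := eqVneq v 0.
  by rewrite qform0.
exact/ltW/Apos.
Qed.

Lemma posdefZ a A : 0 < a -> posdef A -> posdef (a *: A).
Proof.
move=> a_gt0 [Ah Apos]; split=> [|v vN0].
  by rewrite adjmxZ Ah conj_Creal // gtr0_real.
by rewrite qformZ mulr_gt0 ?Apos.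
Qed.

Lemma posdefD A B : posdef A -> possemidef B -> posdef (A + B).
Proof.
move=> [Ah Apos] [Bh Bpos]; split=> [|v vN0]; first by rewrite adjmxD Ah Bh.
by rewrite qformD ltr_wpDr ?Apos.
Qed.

Lemma possemidefZ a A : 0 <= a -> possemidef A -> possemidef (a *: A).
Proof.
move=> a_ge0 [Ah Apos]; split=> [|v].
  by rewrite adjmxZ Ah conj_Creal // ger0_real.
by rewrite qformZ mulr_ge0.
Qed.

Lemma possemidefD A B : possemidef A -> possemidef B -> possemidef (A + B).
Proof.
move=> [Ah Apos] [Bh Bpos]; split=> [|v]; first by rewrite adjmxD Ah Bh.
by rewrite qformD addr_ge0.
Qed.

Lemma possemidef_outer h : possemidef (h *m h^t*).
Proof.
split=> [|v]; first by rewrite adjmxM adjmxK.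
by rewrite qform_outer exprn_ge0.
Qed.

Lemma possemidef_sum (I : finType) (P : pred I) (F : I -> 'M[C]_n) :
  (forall k, P k -> possemidef (F k)) -> possemidef (\sum_(k | P k) F k).
Proof.
move=> Fpos; elim/big_ind: _ => //; last exact: possemidefD.
split=> [|v]; first by rewrite trmx0 map_mx0.
by rewrite /qform mulmx0 mul0mx mxE.
Qed.

(** The diagonal entries are the values of the form at the standard basis vectors, hence
    nonnegative; that they are real comes from [A] being Hermitian. *)
Lemma possemidef_diag_part A : possemidef A -> possemidef (diag_part A).
Proof.
move=> [Ah Apos].
have dA k : qform A (delta_mx k 0) = A k k.
  rewrite /qform trmx_delta map_delta_mx -rowE.
  by rewrite -colE !mxE.
split=> [|v]; last first.
  rewrite qform_diag sumr_ge0 // => k _.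
  by rewrite mxE mulr_ge0 ?exprn_ge0 // -dA.
rewrite /diag_part tr_diag_mx map_diag_mx; congr diag_mx.
apply/matrixP=> j k; rewrite !mxE.
by rewrite -[in RHS]Ah !mxE.
Qed.

(** A nonzero row [u] in the left kernel would make the form vanish at the nonzero vector [u^t*]. *)
Lemma posdef_unit A : posdef A -> A \in unitmx.
Proof.
move=> [Ah Apos]; rewrite -row_free_unit -kermx_eq0.
apply: contraT => /rowV0Pn [u /sub_kermxP uA0 uN0].
have := Apos (u^t*) _; rewrite /qform adjmxK uA0 mul0mx mxE ltxx.
by apply; apply: contra uN0 => /eqP u0; rewrite -[u]adjmxK u0 trmx0 map_mx0.
Qed.

(** For positive definite [A] this is the maximum over nonzero [g] of the quotient
    [|g^* h|^2 / (g^* A g)], as the Cauchy-Schwarz lemmas below show for nonzero [h]. *)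
Definition inv_gain A h : C := (h^t* *m invmx A *m h) 0 0.

Section PositiveDefinite.

Variables (A : 'M[C]_n) (h : 'cV[C]_n).
Hypotheses (Apos : posdef A) (hN0 : h != 0).

Let w := invmx A *m h.

Lemma mulmx_invmx : A *m w = h.
Proof. by rewrite mulKVmx // posdef_unit. Qed.

Lemma invmx_mul_neq0 : w != 0.
Proof. by apply: contra hN0 => /eqP w0; rewrite -mulmx_invmx w0 mulmx0. Qed.

Lemma inner_invmx g : (w^t* *m A *m g) 0 0 = (h^t* *m g) 0 0.
Proof. by rewrite -{1}(proj1 Apos) -adjmxM mulmx_invmx. Qed.

Lemma inv_gainE : inv_gain A h = qform A w.
Proof. by rewrite /qform inner_invmx mulmxA. Qed.

Lemma inv_gain_gt0 : 0 < inv_gain A h.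
Proof. by rewrite inv_gainE; apply: (proj2 Apos); exact: invmx_mul_neq0. Qed.

Lemma inner_invmx_gain : (w^t* *m h) 0 0 = inv_gain A h.
Proof. by rewrite -{1}mulmx_invmx mulmxA inv_gainE. Qed.

(** Pythagoras for the inner product of [A]: since [w^* A g = h^* g] and [w^* A w = inv_gain A h],
    the subtracted multiple of [w] is the orthogonal projection of [g] on [w]. The inequality and
    its equality case are both read off from this identity. *)
Lemma qform_residual g :
  qform A (g - ((h^t* *m g) 0 0 / inv_gain A h) *: w) =
  qform A g - `|(g^t* *m h) 0 0| ^+ 2 / inv_gain A h.
Proof.
have xN0 : inv_gain A h != 0 by rewrite gt_eqF // inv_gain_gt0.
have xR : (inv_gain A h)^* = inv_gain A h.
  by rewrite conj_Creal // gtr0_real // inv_gain_gt0.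
rewrite -scaleNr /qform adjmxD adjmxZ !mulmxDl !mulmxDr -!scalemxAl -!scalemxAr.
have eD (X Y : 'M[C]_1) : (X + Y) 0 0 = X 0 0 + Y 0 0 by rewrite mxE.
have eZ a (X : 'M[C]_1) : (a *: X) 0 0 = a * X 0 0 by rewrite mxE.
rewrite !eD !eZ !inner_invmx.
have -> : (g^t* *m A *m w) 0 0 = (g^t* *m h) 0 0 by rewrite -mulmxA mulmx_invmx.
have -> : (h^t* *m w) 0 0 = inv_gain A h by rewrite mulmxA.
rewrite normCK -(inner_conj h g) rmorphN rmorphM fmorphV /= xR -(inner_conj g h).
by field.
Qed.

Lemma cauchy_schwarz g : `|(g^t* *m h) 0 0| ^+ 2 <= inv_gain A h * qform A g.
Proof.
have := proj2 (posdefW _ Apos) (g - ((h^t* *m g) 0 0 / inv_gain A h) *: w).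
by rewrite qform_residual subr_ge0 ler_pdivrMr ?inv_gain_gt0 // mulrC.
Qed.

(** Equality makes the form vanish at the residual, which is then zero by definiteness. This gives
    the uniqueness of the best combiner up to scaling. *)
Lemma cauchy_schwarz_eq g :
  `|(g^t* *m h) 0 0| ^+ 2 = inv_gain A h * qform A g -> exists c, g = c *: w.
Proof.
move=> eq_g; exists ((h^t* *m g) 0 0 / inv_gain A h).
apply/eqP; rewrite -subr_eq0; apply: contraT => /(proj2 Apos).
rewrite qform_residual eq_g mulrAC mulfV ?mul1r ?subrr ?ltxx //.
by rewrite gt_eqF // inv_gain_gt0.
Qed.

Lemma cauchy_schwarz_attained c : c != 0 ->
  `|((c *: w)^t* *m h) 0 0| ^+ 2 / qform A (c *: w) = inv_gain A h.
Proof.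
move=> cN0; rewrite qform_scale -inv_gainE adjmxZ -scalemxAl mxE.
rewrite inner_invmx_gain normrM norm_conjC exprMn (gtr0_norm inv_gain_gt0).
have xN0 : inv_gain A h != 0 by rewrite gt_eqF // inv_gain_gt0.
by rewrite -mulf_div divff ?mul1r ?expf_neq0 ?normr_eq0 // expr2 mulfK.
Qed.

End PositiveDefinite.

(** Cauchy-Schwarz for [A], tested at [invmx B *m h], bounds the square of [inv_gain B h] by
    [inv_gain A h] times the [A]-form of that vector. This form is at most its [B]-form, which is
    [inv_gain B h] again, and one factor cancels. *)
Lemma le_inv_gain A B h : posdef A -> possemidef (B - A) -> h != 0 ->
  inv_gain B h <= inv_gain A h.
Proof.
move=> Apos BA hN0.
have Bpos : posdef B by rewrite -[B](subrKC A); exact: posdefD.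
have xB := inv_gain_gt0 _ _ Bpos hN0.
have := cauchy_schwarz _ _ Apos hN0 (invmx B *m h).
rewrite inner_invmx_gain // => le1.
have le2 : qform A (invmx B *m h) <= inv_gain B h.
  by rewrite inv_gainE // -{2}[B](subrKC A) qformD lerDl; apply: (proj2 BA).
have := le_trans le1 (ler_wpM2l (ltW (inv_gain_gt0 _ _ Apos hN0)) le2).
by rewrite gtr0_norm // expr2 ler_pM2r.
Qed.

(** The same argument; the form of [B - A] is now strictly positive at the nonzero test vector. *)
Lemma lt_inv_gain A B h : posdef A -> posdef (B - A) -> h != 0 ->
  inv_gain B h < inv_gain A h.
Proof.
move=> Apos BA hN0.
have Bpos : posdef B by rewrite -[B](subrKC A); apply/posdefD/posdefW.
have xB := inv_gain_gt0 _ _ Bpos hN0.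
have := cauchy_schwarz _ _ Apos hN0 (invmx B *m h).
rewrite inner_invmx_gain // => le1.
have lt2 : qform A (invmx B *m h) < inv_gain B h.
  rewrite inv_gainE // -{2}[B](subrKC A) qformD ltrDl; apply: (proj2 BA).
  exact: invmx_mul_neq0.
have := le_lt_trans le1 (_ : _ < inv_gain A h * inv_gain B h).
rewrite ltr_pM2l ?inv_gain_gt0 // => /(_ lt2).
by rewrite gtr0_norm // expr2 ltr_pM2r.
Qed.

Lemma inv_gainZ a A h : a != 0 -> A \in unitmx ->
  inv_gain (a *: A) h = inv_gain A h / a.
Proof.
move=> aN0 Au; rewrite /inv_gain invmxZ ?unitmxZ ?unitfE //.
by rewrite -scalemxAr -scalemxAl mxE mulrC.
Qed.

(* Sherman-Morrison: the rank-one update still maps [invmx A *m h] to a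
   multiple of [h]. *)
Lemma inv_gain_rank1 A b h : posdef A -> 0 <= b -> h != 0 ->
  inv_gain (A + b *: (h *m h^t*)) h =
  inv_gain A h / (1 + b * inv_gain A h).
Proof.
move=> Apos b_ge0 hN0; set w := invmx A *m h; set B := A + _.
have Bpos : posdef B by apply: posdefD => //; apply/possemidefZ/possemidef_outer.
have cN0 : 1 + b * inv_gain A h != 0.
  by rewrite gt_eqF // ltr_wpDr // mulr_ge0 // ltW // inv_gain_gt0.
have Bw : B *m w = (1 + b * inv_gain A h) *: h.
  rewrite mulmxDl mulmx_invmx // scalerDl scale1r; congr (_ + _).
  rewrite -scalemxAl -scalerA; congr (_ *: _).
  by rewrite -mulmxA [h^t* *m w]mx11_scalar mul_mx_scalar /w mulmxA.
have wE : invmx B *m h = (1 + b * inv_gain A h)^-1 *: w.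
  apply: (scalerI cN0); rewrite scalerA mulfV // scale1r scalemxAr -Bw.
  by rewrite mulKmx // posdef_unit.
rewrite {1}/inv_gain -mulmxA wE -scalemxAr mxE mulmxA -/(inv_gain A h).
by rewrite mulrC.
Qed.

Lemma diag_partD A B : diag_part (A + B) = diag_part A + diag_part B.
Proof. by rewrite -raddfD; congr diag_mx; apply/rowP => k; rewrite !mxE. Qed.

Lemma diag_partZ a A : diag_part (a *: A) = a *: diag_part A.
Proof.
by rewrite /diag_part -linearZ; congr diag_mx; apply/rowP => k; rewrite !mxE.
Qed.

Lemma diag_part1 : diag_part (1%:M : 'M[C]_n) = 1%:M.
Proof.
rewrite -[RHS]diag_const_mx; congr diag_mx.
by apply/rowP => k; rewrite !mxE eqxx.
Qed.

(** * Noise matrices that depend affinely on the received covariance *)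

Section QuantizedNoise.

Variables a b : C.
Implicit Types S D : 'M[C]_n.

(** With [a] = alpha and [b] = 1 - alpha, adding the identity gives K_i as a function of the
    received covariance [S]. This part is kept apart because it is linear in [S]. *)
Definition quantized_cov S : 'M[C]_n := a *: S + b *: diag_part S.

Definition noise_mx S : 'M[C]_n := 1%:M + quantized_cov S.

Lemma quantized_covD S D :
  quantized_cov (S + D) = quantized_cov S + quantized_cov D.
Proof. by rewrite /quantized_cov diag_partD !scalerDr addrACA. Qed.

Lemma quantized_covZ c S : quantized_cov (c *: S) = c *: quantized_cov S.
Proof.
rewrite /quantized_cov diag_partZ scalerDr !scalerA.
by rewrite [a * c]mulrC [b * c]mulrC.
Qed.

Hypotheses (a_gt0 : 0 < a) (b_ge0 : 0 <= b).

Lemma possemidef_quantized_cov S : possemidef S -> possemidef (quantized_cov S).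
Proof.
move=> Spos; apply: possemidefD.
  exact: possemidefZ (ltW a_gt0) Spos.
exact: possemidefZ b_ge0 (possemidef_diag_part S Spos).
Qed.

Lemma posdef_noise_mx S : possemidef S -> posdef (noise_mx S).
Proof.
by move=> Spos; apply: posdefD posdef1 _; exact: possemidef_quantized_cov.
Qed.

(** By linearity the two noise matrices differ by [quantized_cov D], which is positive
    semidefinite. *)
Lemma inv_gain_noise_mono S D h : possemidef S -> possemidef D -> h != 0 ->
  inv_gain (noise_mx (S + D)) h <= inv_gain (noise_mx S) h.
Proof.
move=> Spos Dpos; apply: le_inv_gain; first exact: posdef_noise_mx.
rewrite /noise_mx quantized_covD addrA [X in X - _]addrC addrK.
exact: possemidef_quantized_cov.
Qed.

(** Scaling [S] leaves the identity part alone, so [c *: noise_mx S] exceeds [noise_mx (c *: S)] by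
    [(c - 1)] times the identity. This gap is what makes the inequality strict. *)
Lemma inv_gain_noise_scale c S h : possemidef S -> 1 < c -> h != 0 ->
  inv_gain (noise_mx S) h / c < inv_gain (noise_mx (c *: S)) h.
Proof.
move=> Spos c_gt1 hN0; have c_gt0 : 0 < c by exact: lt_trans c_gt1.
rewrite -inv_gainZ ?gt_eqF //; last exact/posdef_unit/posdef_noise_mx.
apply: lt_inv_gain => //.
  by apply/posdef_noise_mx/possemidefZ => //; exact: ltW.
rewrite /noise_mx quantized_covZ scalerDr opprD addrACA subrr addr0.
rewrite -{2}[1%:M]scale1r -scalerBl; apply: posdefZ; last exact: posdef1.
by rewrite subr_gt0.
Qed.

Lemma posdef_interference S D : possemidef S -> possemidef D ->
  posdef ((a ^+ 2) *: S + a%:M + (a * b) *: diag_part D).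
Proof.
move=> Spos Dpos; apply: posdefD; last first.
  apply/possemidefZ/possemidef_diag_part => //.
  by rewrite mulr_ge0 // ltW.
rewrite addrC -scalemx1; apply: posdefD; first exact/posdefZ/posdef1.
by apply: possemidefZ => //; rewrite exprn_ge0 // ltW.
Qed.

(** [S] collects the interferers and [l *: D] the user's own signal. The diagonal part already
    contains both, so only the term in [a ^+ 2] has to be completed; then a factor [a] comes out. *)
Lemma interference_noise_mx l S D :
  (a ^+ 2) *: S + a%:M + (a * b) *: diag_part (l *: D + S) +
    (a ^+ 2 * l) *: D =
  a *: noise_mx (l *: D + S).
Proof.
rewrite /noise_mx /quantized_cov !scalerDr !scalerA scalemx1.
move: (diag_part _) => E; rewrite -expr2.
move: (a ^+ 2 *: S) (a%:M) (_ *: E) (_ *: D) => X Y Z W.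
by rewrite [X + Y]addrC -!addrA; congr (_ + _); rewrite addrA [RHS]addrC.
Qed.

End QuantizedNoise.

End HermitianForms.

(** * Fixed points of standard interference functions *)

Section InterferenceFunction.

Context {R : realType} {I : finType}.
Variable T : (I -> R) -> I -> R.

Hypothesis T_gt0 : forall l, (forall k, 0 <= l k) -> forall k, 0 < T l k.
Hypothesis T_mono : forall l m, (forall k, 0 <= l k) ->
  (forall k, l k <= m k) -> forall k, T l k <= T m k.
Hypothesis T_scal : forall l c, (forall k, 0 <= l k) -> 1 < c ->
  forall k, T (fun j => c * l j) k < c * T l k.

(* Knaster-Tarski on the pointwise infimum of the feasible vectors; no
   continuity of [T] is involved. *)
Lemma interference_least_fixpoint m0 :
  (forall k, 0 <= m0 k) -> (forall k, T m0 k <= m0 k) ->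
  exists l, [/\ forall k, 0 <= l k, forall k, l k = T l k &
    forall m, (forall k, 0 <= m k) -> (forall k, T m k <= m k) ->
    forall k, l k <= m k].
Proof.
move=> m0_ge0 Tm0.
pose E k : classical_sets.set R := fun x => exists m : I -> R,
  [/\ forall j, 0 <= m j, forall j, T m j <= m j & x = m k].
pose l k := inf (E k).
have E_ge0 k : classical_sets.lbound (E k) 0 by move=> x [m [m_ge0 _ ->]].
(* The feasible vector [m0] keeps [E k] from being empty, so that [inf] is a genuine greatest lower
   bound. *)
have E_n0 k : classical_sets.nonempty (E k) by exists (m0 k), m0.
have l_ge0 k : 0 <= l k by apply: lb_le_inf.
have l_le m : (forall k, 0 <= m k) -> (forall k, T m k <= m k) ->
    forall k, l k <= m k.
  by move=> m_ge0 Tm k; apply: ge_inf; [exists 0; exact: E_ge0 | exists m].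
have Tl k : T l k <= l k.
  apply: lb_le_inf => // x [m [m_ge0 Tm ->]].
  by apply: le_trans (Tm k); apply: T_mono => // j; exact: l_le.
exists l; split=> // k; apply/le_anti; rewrite Tl andbT.
have Tl_ge0 j : 0 <= T l j by exact/ltW/T_gt0.
by apply: l_le => // j; exact: T_mono.
Qed.

(** At an index [k] where [m / l] is largest, with ratio [c > 1], one has [m <= c l] everywhere and
    equality at [k]. Then [m k = T m k <= T (c l) k < c * T l k = m k], a contradiction. Exchanging
    the two fixed points gives uniqueness. *)
Lemma interference_fixpoint_le l m :
  (forall k, 0 <= l k) -> (forall k, l k = T l k) ->
  (forall k, 0 <= m k) -> (forall k, m k = T m k) ->
  forall k, m k <= l k.
Proof.
move=> l_ge0 Tl m_ge0 Tm k0.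
have l_gt0 k : 0 < l k by rewrite Tl T_gt0.
rewrite leNgt; apply/negP => lt_lm.
case: (arg_maxP (fun k => m k / l k) (erefl : xpredT k0)) => k _ kmax.
pose c := m k / l k.
have c_gt1 : 1 < c.
  by apply: lt_le_trans (kmax k0 isT); rewrite /= ltr_pdivlMr // mul1r.
have mE : m k = c * l k by rewrite divfK // gt_eqF.
have m_le j : m j <= c * l j by rewrite -ler_pdivrMr //; exact: kmax.
have := le_lt_trans (T_mono _ _ m_ge0 m_le k) (T_scal _ _ l_ge0 c_gt1 k).
by rewrite -Tl -Tm -mE ltxx.
Qed.

End InterferenceFunction.

(** * Passage from inequalities in [R[i]] to inequalities in [R] *)

Section RealParts.

Local Open Scope complex_scope.

Context {R : realType}.

Lemma le_Re (a b : R[i]) : a <= b -> complex.Re a <= complex.Re b.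
Proof. by case: a b => [x y] [z t]; rewrite lecE => /andP[]. Qed.

Lemma lt_Re_div (a b : R[i]) (c : R) :
  a / c%:C < b -> complex.Re a / c < complex.Re b.
Proof.
rewrite -(fmorphV (real_complex R)); case: a b => [x y] [z t].
by rewrite ltcE => /andP[_] /=; rewrite mulr0 subr0.
Qed.

Lemma le_invM (s x y : R) :
  0 < s -> 0 < y -> y <= x -> (s * x)^-1 <= (s * y)^-1.
Proof.
move=> s_gt0 y_gt0 le_yx; have x_gt0 := lt_le_trans y_gt0 le_yx.
by rewrite lef_pV2 ?posrE ?(mulr_gt0 s_gt0) // ler_pM2l.
Qed.

Lemma lt_invM (s x y c : R) :
  0 < s -> 0 < x -> 0 < c -> x / c < y -> (s * y)^-1 < c * (s * x)^-1.
Proof.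
move=> s_gt0 x_gt0 c_gt0 lt_xy.
have y_gt0 : 0 < y by apply: lt_trans lt_xy; rewrite divr_gt0.
rewrite -[X in _ < X * _]invrK -invfM.
rewrite ltf_pV2 ?posrE ?(mulr_gt0 s_gt0) ?(mulr_gt0, invr_gt0) //.
by rewrite mulrCA ltr_pM2l // mulrC.
Qed.

End RealParts.

(** * Uplink covariances, the SINR as a quotient, and the power map *)

Section Uplink.

Local Open Scope complex_scope.

Context {R : realType} {Nc Nu Nb : nat}.
Variable h : 'I_Nc -> 'I_Nc -> 'I_Nu -> 'cV[R[i]]_Nb.
Variables (alpha : R) (gamma : 'I_Nc -> 'I_Nu -> R).
Implicit Types lam mu : 'I_Nc -> 'I_Nu -> R.

Definition interference_cov (P : pred ('I_Nc * 'I_Nu)) lam i : 'M[R[i]]_Nb :=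
  \sum_(p | P p) (lam p.1 p.2)%:C *: (h i p.1 p.2 *m (h i p.1 p.2)^t*).

Definition channel_cov := interference_cov xpredT.

(** The product of a block row, a block diagonal and a block column is a sum over cells; inside each
    cell, the product with a diagonal matrix expands into weighted outer products. *)
Lemma received_covE lam i : received_cov h lam i = channel_cov lam i.
Proof.
rewrite /received_cov /channel_mx /power_mx diag_mxrow mul_mxrow_mxdiag.
rewrite tr_mxrow.
set B := fun j => (\matrix_(k, v) h i j v k 0)^T.
have -> : (\mxcol_j B j) ^ Num.conj = \mxcol_j (B j ^ Num.conj).
  by apply/matrixP=> k l; rewrite !mxE.
rewrite mul_mxrow_mxcol /channel_cov /interference_cov.
rewrite -(pair_bigA _ (fun j v =>
  (lam j v)%:C *: (h i j v *m (h i j v)^t*))) /=.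
apply: eq_bigr => j _; apply/matrixP=> k l.
rewrite mul_mx_diag mxE summxE; apply: eq_bigr => v _.
by rewrite !mxE big_ord1 !mxE mulrAC mulrC.
Qed.

Lemma possemidef_interference_cov P lam i :
  (forall j v, 0 <= lam j v) -> possemidef (interference_cov P lam i).
Proof.
move=> lam_ge0; apply: possemidef_sum => p _.
by apply/possemidefZ/possemidef_outer; rewrite lecR.
Qed.

(** The covariance is linear in the powers. The increment is itself written as a covariance so that
    it is positive semidefinite as soon as [lam <= mu]. *)
Lemma channel_covB lam mu i : channel_cov mu i =
  channel_cov lam i + channel_cov (fun j v => mu j v - lam j v) i.
Proof.
rewrite -big_split; apply: eq_bigr => p _.
by rewrite /= -scalerDl -rmorphD /= subrKC.
Qed.

Lemma channel_covZ c lam i :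
  channel_cov (fun j v => c * lam j v) i = c%:C *: channel_cov lam i.
Proof.
rewrite scaler_sumr; apply: eq_bigr => p _.
by rewrite rmorphM scalerA.
Qed.

Lemma channel_covD1 lam i u : channel_cov lam i =
  (lam i u)%:C *: (h i i u *m (h i i u)^t*) +
  interference_cov (fun p => p != (i, u)) lam i.
Proof. by rewrite /channel_cov /interference_cov (bigD1 (i, u)). Qed.

Lemma KmxE lam i : Kmx h alpha lam i =
  noise_mx alpha%:C (1 - alpha)%:C (channel_cov lam i).
Proof.
have covE : \sum_j \sum_v (lam j v)%:C *: (h i j v *m (h i j v)^t*) =
    channel_cov lam i by rewrite pair_bigA.
rewrite /Kmx received_covE covE.
by move: (channel_cov _ _) => S; rewrite -addrA.
Qed.

Definition mmse_mx lam i u : 'M[R[i]]_Nb :=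
  alpha%:C ^+ 2 *: interference_cov (fun p => p != (i, u)) lam i
  + alpha%:C%:M
  + (alpha%:C * (1 - alpha)%:C) *: diag_part (channel_cov lam i).

Lemma mmseE lam i u :
  mmse h alpha lam i u = invmx (mmse_mx lam i u) *m h i i u.
Proof.
by rewrite /mmse /mmse_mx received_covE (rmorphXn (real_complex R))
  (rmorphM (real_complex R)).
Qed.

(** The thermal noise contributes [alpha ^+ 2] and the identity inside the quantization noise
    [alpha * (1 - alpha)]. Together they give the [alpha] in front of the identity in [mmse_mx]. *)
Lemma sinrE lam i u g : sinr h alpha lam i u g =
  (alpha ^+ 2 * lam i u)%:C * `|(g^t* *m h i i u) 0 0| ^+ 2 /
  qform (mmse_mx lam i u) g.
Proof.
congr (_ / _).
rewrite /mmse_mx -scalemx1 !qformD !qformZ qform_sum.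
under [in RHS]eq_bigr do rewrite qformZ qform_outer.
move: (\sum_(p | _) _) => I.
rewrite -/(qform (qnoise_cov h alpha lam i) g) /qnoise_cov received_covE.
rewrite diag_partD diag_part1 qformZ qformD -qform1.
move: (qform _ _) (qform _ _) => D N.
rewrite (rmorphXn (real_complex R)) (rmorphM (real_complex R)).
rewrite !(rmorphB (real_complex R)) !(rmorph1 (real_complex R)).
by ring.
Qed.

Hypotheses (alpha_gt0 : 0 < alpha) (alpha_le1 : alpha <= 1).

Let alphaC_gt0 : 0 < alpha%:C :> R[i].
Proof. by rewrite ltcR. Qed.

Let betaC_ge0 : 0 <= (1 - alpha)%:C :> R[i].
Proof. by rewrite lecR subr_ge0. Qed.

Lemma posdef_Kmx lam i :
  (forall j v, 0 <= lam j v) -> posdef (Kmx h alpha lam i).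
Proof.
move=> lam_ge0; rewrite KmxE; apply: (posdef_noise_mx _ _ alphaC_gt0 betaC_ge0).
exact: possemidef_interference_cov.
Qed.

Lemma posdef_mmse_mx lam i u :
  (forall j v, 0 <= lam j v) -> posdef (mmse_mx lam i u).
Proof.
move=> lam_ge0.
by apply: (posdef_interference _ _ alphaC_gt0 betaC_ge0);
  exact: possemidef_interference_cov.
Qed.

Lemma mmse_mx_Kmx lam i u :
  mmse_mx lam i u +
    (alpha%:C ^+ 2 * (lam i u)%:C) *: (h i i u *m (h i i u)^t*) =
  alpha%:C *: Kmx h alpha lam i.
Proof.
rewrite KmxE /mmse_mx (channel_covD1 _ _ u).
exact: interference_noise_mx.
Qed.

Lemma Kmx_gain_mono lam mu i g : g != 0 -> (forall j v, 0 <= lam j v) ->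
  (forall j v, lam j v <= mu j v) ->
  inv_gain (Kmx h alpha mu i) g <= inv_gain (Kmx h alpha lam i) g.
Proof.
move=> gN0 lam_ge0 le_lm; rewrite !KmxE (channel_covB lam mu).
apply: (inv_gain_noise_mono _ _ alphaC_gt0 betaC_ge0) => //.
  exact: possemidef_interference_cov.
by apply: possemidef_interference_cov => j v; rewrite subr_ge0.
Qed.

Lemma Kmx_gain_scale c lam i g : g != 0 -> (forall j v, 0 <= lam j v) ->
  1 < c -> inv_gain (Kmx h alpha lam i) g / c%:C <
           inv_gain (Kmx h alpha (fun j v => c * lam j v) i) g.
Proof.
move=> gN0 lam_ge0 c_gt1; rewrite !KmxE channel_covZ.
apply: (inv_gain_noise_scale _ _ alphaC_gt0 betaC_ge0) => //.
  exact: possemidef_interference_cov.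
by rewrite ltcR.
Qed.

Hypotheses (gamma_gt0 : forall i u, 0 < gamma i u)
  (hN0 : forall i u, h i i u != 0).

(** Taking the real part loses nothing for nonnegative powers, where the value is real, and lets the
    fixed-point argument run over [R]. *)
Definition gain lam i u : R :=
  complex.Re (inv_gain (Kmx h alpha lam i) (h i i u)).

(** This is the interference function T whose fixed points are the solutions of [power_equation]. *)
Definition power_map lam i u : R :=
  (alpha * (1 + (gamma i u)^-1) * gain lam i u)^-1.

Lemma gainE lam i u : (forall j v, 0 <= lam j v) ->
  (gain lam i u)%:C = inv_gain (Kmx h alpha lam i) (h i i u).
Proof.
move=> lam_ge0; rewrite RRe_real // gtr0_real // inv_gain_gt0 //.
exact: posdef_Kmx.
Qed.

Lemma gain_gt0 lam i u : (forall j v, 0 <= lam j v) -> 0 < gain lam i u.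
Proof.
by move=> lam_ge0; rewrite -ltcR gainE // inv_gain_gt0 //; exact: posdef_Kmx.
Qed.

Let slope_gt0 i u : 0 < alpha * (1 + (gamma i u)^-1).
Proof. by rewrite mulr_gt0 // addr_gt0 // invr_gt0. Qed.

Lemma power_map_gt0 lam i u :
  (forall j v, 0 <= lam j v) -> 0 < power_map lam i u.
Proof. by move=> lam_ge0; rewrite invr_gt0 mulr_gt0 // gain_gt0. Qed.

Lemma power_map_mono lam mu i u : (forall j v, 0 <= lam j v) ->
  (forall j v, lam j v <= mu j v) -> power_map lam i u <= power_map mu i u.
Proof.
move=> lam_ge0 le_lm.
have mu_ge0 j v : 0 <= mu j v by exact: le_trans (le_lm j v).
apply: (le_invM _ _ _ (slope_gt0 i u) (gain_gt0 mu i u mu_ge0)).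
exact: (le_Re _ _ (Kmx_gain_mono _ _ _ _ (hN0 i u) lam_ge0 le_lm)).
Qed.

Lemma power_map_scale c lam i u : (forall j v, 0 <= lam j v) -> 1 < c ->
  power_map (fun j v => c * lam j v) i u < c * power_map lam i u.
Proof.
move=> lam_ge0 c_gt1; have c_gt0 : 0 < c by exact: lt_trans c_gt1.
apply: (lt_invM _ _ _ _ (slope_gt0 i u) (gain_gt0 lam i u lam_ge0) c_gt0).
exact: (lt_Re_div _ _ _ (Kmx_gain_scale _ _ _ _ (hN0 i u) lam_ge0 c_gt1)).
Qed.

Lemma power_equationP lam : power_equation h alpha gamma lam <->
  (forall i u, 0 <= lam i u) /\ (forall i u, lam i u = power_map lam i u).
Proof.
have mapE i u : (forall j v, 0 <= lam j v) -> (power_map lam i u)%:C =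
    1 / (alpha%:C * (1 + 1 / (gamma i u)%:C) *
         ((h i i u)^t* *m invmx (Kmx h alpha lam i) *m h i i u) 0 0).
  move=> lam_ge0; rewrite -/(inv_gain _ _) -gainE // !div1r fmorphV /=.
  by rewrite !rmorphM rmorphD fmorphV.
split=> [lamE|[lam_ge0 lamE] i u]; last by rewrite -mapE // -lamE.
have lam_ge0 i u : 0 <= lam i u by case: (lamE i u).
split=> // i u; apply: (@complexI R); rewrite mapE //.
by case: (lamE i u).
Qed.

(** * Optimal combiners for fixed powers *)

Section Combiner.

Variable lam : 'I_Nc -> 'I_Nu -> R.
Hypothesis lam_ge0 : forall i u, 0 <= lam i u.

Definition max_sinr i u : R[i] :=
  (alpha ^+ 2 * lam i u)%:C * inv_gain (mmse_mx lam i u) (h i i u).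

Let Mpos i u : posdef (mmse_mx lam i u).
Proof. exact: posdef_mmse_mx. Qed.

Let weight_ge0 i u : 0 <= (alpha ^+ 2 * lam i u)%:C :> R[i].
Proof. by rewrite lecR mulr_ge0 // exprn_ge0 // ltW. Qed.

Lemma mmse_neq0 i u : mmse h alpha lam i u != 0.
Proof. by rewrite mmseE invmx_mul_neq0. Qed.

Lemma sinr_le i u g : g != 0 -> sinr h alpha lam i u g <= max_sinr i u.
Proof.
move=> gN0; rewrite sinrE -mulrA ler_wpM2l //.
by rewrite ler_pdivrMr ?(proj2 (Mpos i u)) // cauchy_schwarz.
Qed.

Lemma sinr_mmse i u c : c != 0 ->
  sinr h alpha lam i u (c *: mmse h alpha lam i u) = max_sinr i u.
Proof.
move=> cN0; rewrite sinrE -mulrA; congr (_ * _).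
rewrite mmseE; exact: (cauchy_schwarz_attained _ _ (Mpos i u) (hN0 i u)).
Qed.

(** A positive power allows the weight to be cancelled, which leaves the equality case of
    Cauchy-Schwarz. At zero power every combiner has SINR zero. *)
Lemma sinr_max_eq i u g : 0 < lam i u -> g != 0 ->
  sinr h alpha lam i u g = max_sinr i u ->
  exists2 c, c != 0 & g = c *: mmse h alpha lam i u.
Proof.
move=> lam_gt0 gN0; rewrite sinrE -mulrA => /mulfI eq_g.
have [|c gE] := cauchy_schwarz_eq _ _ (Mpos i u) (hN0 i u) g.
  rewrite -eq_g ?divfK ?gt_eqF ?(proj2 (Mpos i u)) //.
  by rewrite ltcR mulr_gt0 // exprn_gt0.
exists c; last by rewrite mmseE.
by apply: contraNneq gN0 => c0; rewrite gE c0 scale0r.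
Qed.

Lemma sinr_maximizer_mmse i u c : c != 0 ->
  sinr_maximizer h alpha lam i u (c *: mmse h alpha lam i u).
Proof.
move=> cN0; split=> [|g gN0]; first by rewrite scaler_eq0 negb_or cN0 mmse_neq0.
by rewrite sinr_mmse // sinr_le.
Qed.

Lemma max_sinr_attained i u g :
  sinr_maximizer h alpha lam i u g -> sinr h alpha lam i u g = max_sinr i u.
Proof.
move=> [gN0 gmax]; apply/le_anti; rewrite sinr_le //=.
rewrite -(sinr_mmse i u 1 (oner_neq0 _)) scale1r.
exact: gmax (mmse_neq0 i u).
Qed.

(** With [t] the maximal SINR, Sherman-Morrison gives [gain = alpha * m / (1 + t)]. Hence
    [power_map <= lam] reads [1 + t <= (1 + 1/gamma) * t], that is [gamma <= t]. *)
Lemma max_sinr_ge i u :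
  ((gamma i u)%:C <= max_sinr i u) = (power_map lam i u <= lam i u).
Proof.
have x_gt0 := inv_gain_gt0 _ _ (Mpos i u) (hN0 i u).
have [m mE] : exists m : R, m%:C = inv_gain (mmse_mx lam i u) (h i i u).
  by eexists; apply: RRe_real; exact: gtr0_real.
have m_gt0 : 0 < m by rewrite -ltcR mE.
rewrite /max_sinr -mE -rmorphM lecR.
set t := alpha ^+ 2 * lam i u * m.
have t_ge0 : 0 <= t by rewrite mulr_ge0 ?mulr_ge0 ?exprn_ge0 // ltW.
have t1_gt0 : 0 < 1 + t by rewrite ltr_wpDr.
have xE : gain lam i u = alpha * m / (1 + t).
  (* The rank-one weight [alpha ^+ 2 * lam i u] turns [mmse_mx] into [alpha] times [Kmx], so the
     gains of the two matrices determine each other. *)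
  have := inv_gain_rank1 _ _ _ (Mpos i u) (weight_ge0 i u) (hN0 i u).
  rewrite (rmorphM (real_complex R)) (rmorphXn (real_complex R)) mmse_mx_Kmx.
  rewrite (inv_gainZ _ _ _ (lt0r_neq0 alphaC_gt0)); last first.
    exact/posdef_unit/posdef_Kmx.
  move/(etrans (congr1 (fun z => z / alpha%:C) (gainE lam i u lam_ge0))).
  rewrite -mE.
  move: (gain lam i u) => x.
  rewrite -(rmorphXn (real_complex R)) -!(rmorphM (real_complex R)).
  rewrite -(rmorph1 (real_complex R)) -(rmorphD (real_complex R)).
  rewrite -!(fmorphV (real_complex R)) -!(rmorphM (real_complex R)).
  move=> /complexI xE.
  by rewrite -mulrA -xE mulrC divfK // lt0r_neq0.
have lamE : lam i u * (alpha * (1 + (gamma i u)^-1) * gain lam i u) =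
    (1 + (gamma i u)^-1) * t / (1 + t) by rewrite xE /t; ring.
rewrite /power_map -[X in _ = (X <= _)]mul1r ler_pdivrMr; last first.
  by rewrite mulr_gt0 ?gain_gt0.
rewrite lamE ler_pdivlMr // mul1r mulrDl mul1r addrC lerD2l.
by rewrite mulrC ler_pdivlMr // mul1r.
Qed.

End Combiner.

(** This separates the variables: the powers satisfy an inequality free of [f], and the combiners
    are fixed up to scaling once the powers are known. *)
Lemma P1_feasibleP f lam : P1_feasible h alpha gamma f lam <->
  [/\ forall i u, 0 <= lam i u, forall i u, power_map lam i u <= lam i u &
      forall i u, exists2 c : R[i],
        c != 0 & f i u = c *: mmse h alpha lam i u].
Proof.
split=> [feas|[lam_ge0 le_lam fE] i u]; last first.
  have [c cN0 ->] := fE i u.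
  split; [exact: lam_ge0 | exact: sinr_maximizer_mmse |].
  rewrite (sinr_mmse _ lam_ge0 _ _ _ cN0) (max_sinr_ge _ lam_ge0).
  exact: le_lam.
have lam_ge0 i u : 0 <= lam i u by case: (feas i u).
have maxE i u := max_sinr_attained _ lam_ge0 i u (f i u).
have le_lam i u : power_map lam i u <= lam i u.
  have [_ /maxE fE] := feas i u.
  by rewrite fE (max_sinr_ge _ lam_ge0).
split; [exact: lam_ge0 | exact: le_lam | move=> i u].
have [_ fmax _] := feas i u.
apply: (sinr_max_eq _ lam_ge0) (maxE _ _ fmax); last by case: fmax.
(* Feasible powers dominate the positive [power_map], so they are positive, as the uniqueness of the
   combiner requires. *)
by apply: lt_le_trans (le_lam i u); exact: power_map_gt0.
Qed.

End Uplink.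

(** * Solution of the power minimization problem *)

Lemma P1_feasible_neq0 (R : realType) (Nc Nu Nb : nat)
    (h : 'I_Nc -> 'I_Nc -> 'I_Nu -> 'cV[R[i]]_Nb) (alpha : R)
    (gamma : 'I_Nc -> 'I_Nu -> R) f lam :
  (forall i u, 0 < gamma i u) -> P1_feasible h alpha gamma f lam ->
  forall i u, h i i u != 0.
Proof.
move=> gamma_gt0 feas i u; apply/eqP => h0.
have [_ _] := feas i u.
(* A zero direct channel makes the user's SINR vanish, against the positive target. *)
by rewrite /sinr h0 mulmx0 mxE normr0 expr0n mulr0 mul0r lecR leNgt gamma_gt0.
Qed.

Local Open Scope complex_scope.

Theorem corollary2 (R : realType) (Nc Nu Nb : nat)
    (Nc_gt0 : (0 < Nc)%N) (Nu_gt0 : (0 < Nu)%N) (Nb_gt0 : (0 < Nb)%N)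
    (h : 'I_Nc -> 'I_Nc -> 'I_Nu -> 'cV[R[i]]_Nb)
    (alpha : R) (alpha_gt0 : 0 < alpha) (alpha_le1 : alpha <= 1)
    (gamma : 'I_Nc -> 'I_Nu -> R) (gamma_gt0 : forall i u, 0 < gamma i u)
    (feasible : exists f lam, P1_feasible h alpha gamma f lam) :
  (exists! lam : 'I_Nc -> 'I_Nu -> R, power_equation h alpha gamma lam) /\
  (forall (f : 'I_Nc -> 'I_Nu -> 'cV[R[i]]_Nb) (lam : 'I_Nc -> 'I_Nu -> R),
     P1_optimal h alpha gamma f lam <->
     power_equation h alpha gamma lam /\
     (forall i u, exists2 c : R[i],
        c != 0 & f i u = c *: mmse h alpha lam i u)).
Proof.
have [f0 [lam0 feas0]] := feasible.
have hN0 := P1_feasible_neq0 _ _ _ _ _ _ _ _ _ gamma_gt0 feas0.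
have feasP f lam := P1_feasibleP h alpha gamma alpha_gt0 alpha_le1 gamma_gt0
  hN0 f lam.
have peqP lam := power_equationP h alpha gamma alpha_gt0 alpha_le1 hN0 lam.
(* The power map is uncurried, since the fixed-point lemmas work over a single finite index type. *)
pose T (l : 'I_Nc * 'I_Nu -> R) (p : 'I_Nc * 'I_Nu) :=
  power_map h alpha gamma (fun i u => l (i, u)) p.1 p.2.
have T_gt0 l : (forall k, 0 <= l k) -> forall k, 0 < T l k.
  by move=> l_ge0 k; apply: power_map_gt0.
have T_mono l m : (forall k, 0 <= l k) -> (forall k, l k <= m k) ->
    forall k, T l k <= T m k.
  by move=> l_ge0 lm k; apply: power_map_mono.
have T_scal l c : (forall k, 0 <= l k) -> 1 < c ->
    forall k, T (fun j => c * l j) k < c * T l k.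
  move=> l_ge0 c_gt1 k.
  exact: (power_map_scale _ _ _ _ _ _ _ _ (fun i u => l (i, u))).
have [lam0_ge0 Tlam0 _] := (feasP _ _).1 feas0.
have [l [l_ge0 lE l_le]] := interference_least_fixpoint T T_gt0 T_mono
  (fun p => lam0 p.1 p.2) (fun p => lam0_ge0 p.1 p.2)
  (fun p => Tlam0 p.1 p.2).
pose ls i u := l (i, u).
have ls_eq : power_equation h alpha gamma ls.
  by apply/peqP; split=> i u; [exact: l_ge0 | exact: lE (i, u)].
have ls_uniq lam : power_equation h alpha gamma lam -> lam = ls.
  move=> /peqP[lam_ge0 lamE].
  apply/boolp.funext => i; apply/boolp.funext => u; apply/le_anti.
  have fix_le := interference_fixpoint_le T T_gt0 T_mono T_scal.
  have lamE' k : lam k.1 k.2 = T (fun p => lam p.1 p.2) k by exact: lamE.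
  have lam_ge0' (k : 'I_Nc * 'I_Nu) : 0 <= lam k.1 k.2 by exact: lam_ge0.
  apply/andP; split.
    exact: (fix_le l _ l_ge0 lE lam_ge0' lamE' (i, u)).
  exact: (fix_le _ l lam_ge0' lamE' l_ge0 lE (i, u)).
(* The fixed point lies below every feasible power vector in each component, which is more than
   minimality of the sum. *)
have ls_le f lam : P1_feasible h alpha gamma f lam ->
    forall i u, ls i u <= lam i u.
  move=> /feasP[lam_ge0 Tlam _] i u.
  exact: (l_le (fun p => lam p.1 p.2) (fun p => lam_ge0 p.1 p.2)
    (fun p => Tlam p.1 p.2) (i, u)).
have ls_feas f : (forall i u, exists2 c : R[i],
    c != 0 & f i u = c *: mmse h alpha ls i u) ->
    P1_feasible h alpha gamma f ls.
  move=> fE; apply/feasP; have [ls_ge0 lsE] := (peqP _).1 ls_eq.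
  by split; [exact: ls_ge0 | move=> i u; rewrite [leRHS]lsE | exact: fE].
split; first by exists ls; split=> // lam /ls_uniq.
move=> f lam; split=> [[feas lam_min]|[/ls_uniq -> fE]]; last first.
  split=> [|f' lam' feas']; first exact: ls_feas.
  by do 2!(apply: ler_sum => ? _); exact: ls_le feas' _ _.
have [_ _ fE] := (feasP _ _).1 feas.
(* An optimal [lam] dominates [ls] componentwise, yet its sum is at most that of [ls] used with the
   MMSE combiners; so all the nonnegative differences vanish. *)
have lsE : lam = ls.
  have ls_mmse i u : exists2 c : R[i],
      c != 0 & mmse h alpha ls i u = c *: mmse h alpha ls i u.
    by exists 1; rewrite ?oner_neq0 ?scale1r.
  have := lam_min _ _ (ls_feas _ ls_mmse).
  rewrite !pair_bigA /= -subr_le0 -sumrB => sum_le0.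
  have d_ge0 p : true -> 0 <= lam p.1 p.2 - ls p.1 p.2.
    by rewrite subr_ge0 => _; exact: ls_le feas _ _.
  have /(psumr_eq0P d_ge0) d0 : \sum_p (lam p.1 p.2 - ls p.1 p.2) = 0.
    by apply/le_anti; rewrite sum_le0 sumr_ge0.
  apply/boolp.funext => i; apply/boolp.funext => u.
  by apply/eqP; rewrite -subr_eq0 (d0 (i, u)).
by rewrite lsE in fE *.
Qed.
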